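(* For all integers $1\le j\le n$, \begin{align*} s_{n,j}^{(-1)} & = - \sum_{k=1}^{n-j} s_{n,n+1-k}^{(-1)} \cdot s_{n+1-k,j} + \delta_{n,j} \\ & = - \sum_{k=1}^{n-j} s_{n,n-k} \cdot s_{n-k,j}^{(-1)} + \delta_{n,j} \\ & = -\sum_{k=1}^{n} s_{n,k-1} \cdot s_{k-1,j}^{(-1)} + \delta_{n,j}. \end{align*}
   Context: For integers $i,j\ge 1$ let $s_{i,j} := s_o(i,j)-s_e(i,j)$, where $s_o(i,j)$ (respectively $s_e(i,j)$) is the number of $j$'s appearing in all partitions of $i$ into an odd (respectively even) number of distinct parts. Equivalently, $s_{i,j} = [q^i]\, \frac{q^j}{1-q^j}\,(q;q)_\infty$, where $(q;q)_\infty=\prod_{m\ge1}(1-q^m)$ and $[q^i]$ denotes the coefficient of $q^i$. For $N\ge1$ let $A_N := (s_{i,j})_{1\le i,j\le N}$; this matrix is lower triangular with ones on its diagonal, hence invertible. Let $s_{i,j}^{(-1)}$ denote the $(i,j)$ entry of $A_N^{-1}$, for any $N\ge\max(i,j)$; it does not depend on the choice of such $N$. By convention the term with index $0$ (the $k=1$ term $s_{n,0}\cdot s_{0,j}^{(-1)}$ in the last sum) is $0$. $\delta_{n,j}$ is the Kronecker delta; empty sums are $0$. *)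

(* Defs.v *)
From mathcomp Require Import all_boot all_order all_algebra.

Set Implicit Arguments.
Unset Strict Implicit.
Unset Printing Implicit Defensive.

Import Order.TTheory GRing.Theory Num.Theory.
Local Open Scope ring_scope.

(* A partition of i into distinct parts is encoded as its set of parts, a set
   of positive integers at most i. *)
Definition distinct_partition (i : nat) (P : {set 'I_i.+1}) : bool :=
  (ord0 \notin P) && ((\sum_(k in P) k)%N == i).

Definition s_o (i j : nat) : nat :=
  \sum_(P : {set 'I_i.+1} | distinct_partition P && odd #|P|)
    #|[set k in P | val k == j]|.

Definition s_e (i j : nat) : nat :=
  \sum_(P : {set 'I_i.+1} | distinct_partition P && ~~ odd #|P|)
    #|[set k in P | val k == j]|.

Definition s (i j : nat) : int := (s_o i j)%:Z - (s_e i j)%:Z.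

(* Ordinals start at 0, whereas the rows and columns of A_N start at 1. *)
Definition A (N : nat) : 'M[int]_N := \matrix_(i < N, j < N) s i.+1 j.+1.

(* The (i, j) entry of the inverse of A_N for the least admissible N, namely
   N = max(i, j); lemma [s_invE] shows that any larger N gives the same value.
   The value 0 at index 0 is a convention. *)
Definition s_inv (i j : nat) : int :=
  match i, j with
  | i'.+1, j'.+1 => invmx (A (maxn i' j').+1) (inord i') (inord j')
  | _, _ => 0
  end.

Lemma s_eq0 (i j : nat) : (i < j)%N -> s i j = 0.
Proof.
move=> lt_ij; have E (P : {set 'I_i.+1}) : #|[set k in P | val k == j]| = 0%N.
  apply/eqP; rewrite cards_eq0; apply/eqP/setP => k; rewrite !inE.
  by rewrite ltn_eqF ?andbF //= (leq_ltn_trans _ lt_ij) // -ltnS.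
by rewrite /s /s_o /s_e !big1 ?subrr // => P _; rewrite E.
Qed.

Lemma s_diag (i : nat) : s i.+1 i.+1 = 1.
Proof.
set n := i.+1.
have one (P : {set 'I_n.+1}) : distinct_partition P -> ord_max \in P ->
    P = [set ord_max].
  case/andP=> P0 /eqP sumP maxP; apply/setP=> k; rewrite !inE.
  apply/idP/eqP => [kP|->//]; apply/eqP; apply: contraT => neq_k.
  move: sumP; rewrite (bigD1 ord_max) //= (bigD1 k) /= ?kP //.
  have k0 : (0 < k)%N.
    by rewrite lt0n; apply: contraNneq P0 => k0; rewrite (_ : ord0 = k) //; apply: val_inj.
  by move/eqP; rewrite -[X in _ == X]addn0 eqn_add2l addn_eq0 eqn0Ngt k0.
have cnt (P : {set 'I_n.+1}) :
    #|[set k in P | val k == n]| = (ord_max \in P : nat).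
  case: (boolP (ord_max \in P)) => maxP; last first.
    apply/eqP; rewrite cards_eq0; apply/eqP/setP => k; rewrite !inE.
    apply/negP => /andP[kP /eqP kn]; case/negP: maxP.
    by rewrite (_ : ord_max = k) //; apply: val_inj.
  rewrite -[RHS](cards1 (@ord_max n)); apply: eq_card => k; rewrite !inE.
  rewrite -val_eqE /=; case: eqP => [kn|]; rewrite ?andbF ?andbT //.
  by rewrite (_ : k = ord_max) //; apply: val_inj.
have so1 : s_o n n = 1%N.
  rewrite /s_o (bigD1 [set ord_max]) /=; last first.
    by rewrite /distinct_partition cards1 big_set1 eqxx inE.
  rewrite cnt set11 big1 // => P /andP[/andP[dP _] neqP]; rewrite cnt.
  by case: (boolP (_ \in _)) => // /(one _ dP) eP; rewrite eP eqxx in neqP.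
have se0 : s_e n n = 0%N.
  rewrite /s_e big1 // => P /andP[dP evP]; rewrite cnt.
  by case: (boolP (_ \in _)) => // /(one _ dP) eP; rewrite eP cards1 in evP.
by rewrite /s so1 se0 subr0.
Qed.

Lemma A_unit (N : nat) : A N \in unitmx.
Proof.
rewrite unitmxE det_trig; last first.
  by apply/is_trig_mxP => i j lt_ij; rewrite mxE s_eq0.
by rewrite big1 ?unitr1 // => i _; rewrite mxE s_diag.
Qed.

Lemma invmx_A_widen (M N : nat) (le_MN : (M <= N)%N) (i j : 'I_M) :
  invmx (A M) i j = invmx (A N) (widen_ord le_MN i) (widen_ord le_MN j).
Proof.
pose B := \matrix_(i < M, j < M)
  invmx (A N) (widen_ord le_MN i) (widen_ord le_MN j).
suff AB1 : A M *m B = 1%:M.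
  by rewrite -[invmx _]mulmx1 -AB1 mulKmx ?A_unit // mxE.
apply/matrixP => a b.
have /matrixP/(_ (widen_ord le_MN a) (widen_ord le_MN b)) := mulmxV (A_unit N).
rewrite !mxE -val_eqE /= -[a == b]val_eqE => <-.
rewrite (bigID (fun k : 'I_N => (k < M)%N)) /= [X in _ = _ + X]big1 ?addr0.
  by rewrite big_ord_narrow; apply: eq_bigr => k _; rewrite !mxE.
move=> k; rewrite -leqNgt => le_Mk.
by rewrite mxE /= s_eq0 ?mul0r // ltnS (leq_trans (ltn_ord a)).
Qed.

Lemma s_invE (N : nat) (i j : 'I_N) : s_inv i.+1 j.+1 = invmx (A N) i j.
Proof.
have le_N : ((maxn i j).+1 <= N)%N by rewrite gtn_max !ltn_ord.
rewrite /s_inv (invmx_A_widen le_N).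
by congr (invmx _ _ _); apply: val_inj; rewrite /= inordK // ltnS leq_max leqnn ?orbT.
Qed.

(* Main.v *)
Require Import Defs.
From mathcomp Require Import all_boot all_order all_algebra.
Import GRing.Theory.
Local Open Scope ring_scope.

(** The three formulas are the two matrix identities [A^-1 A = 1] and
    [A A^-1 = 1] read entrywise and solved for one unknown. Both [A] and [A^-1]
    are lower triangular, so in row [n] and column [j] the product sums only
    run over the indices [m] with [j <= m <= n] ([sum_s_inv_s], [sum_s_s_inv]).
    Since [A] has ones on its diagonal, the [m = j] term of the first sum and
    the [m = n] term of the second are both the entry [s_inv n j]; moving the
    other terms across the equality gives the first two recurrences. The third
    one is the second with the vanishing terms [m < j] put back in. *)

(** The index [m = 0], which has no counterpart in the matrices, contributes
    nothing since [s_inv n 0 = 0]; including it lets the shift from ordinals to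
    indices starting at 1 be done once, by splitting off the first term. *)
Lemma sum_s_inv_s_full (N n j : nat) :
  (0 < n <= N)%N -> (0 < j <= N)%N ->
  \sum_(0 <= m < N.+1) s_inv n m * s m j = (n == j)%:R.
Proof.
case: n => // n; case: j => // j /andP[_ ltnN] /andP[_ ltjN].
rewrite big_nat_recl // [s_inv _ 0]/= mul0r add0r big_mkord.
have /matrixP/(_ (Ordinal ltnN) (Ordinal ltjN)) := mulVmx (A_unit N).
rewrite !mxE -val_eqE eqSS => <-.
by apply: eq_bigr => m _; rewrite -s_invE mxE.
Qed.

Lemma sum_s_s_inv_full (N n j : nat) :
  (0 < n <= N)%N -> (0 < j <= N)%N ->
  \sum_(0 <= m < N.+1) s n m * s_inv m j = (n == j)%:R.
Proof.
case: n => // n; case: j => // j /andP[_ ltnN] /andP[_ ltjN].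
rewrite big_nat_recl // [s_inv 0 _]/= mulr0 add0r big_mkord.
have /matrixP/(_ (Ordinal ltnN) (Ordinal ltjN)) := mulmxV (A_unit N).
rewrite !mxE -val_eqE eqSS => <-.
by apply: eq_bigr => m _; rewrite -s_invE mxE.
Qed.

(** Forward substitution: once the entries above row [n] in column [j] are known
    to vanish, row [n] of [A A^-1 = 1] reduces to its diagonal term. *)
Lemma s_inv_eq0 (n j : nat) : (n < j)%N -> s_inv n j = 0.
Proof.
elim/ltn_ind: n => -[|n] IHn ltnj //.
have := sum_s_s_inv_full j n.+1 j; rewrite (ltnW ltnj) (leq_trans _ ltnj) //.
rewrite leqnn (ltn_eqF ltnj) => /(_ isT isT).
rewrite (@big_cat_nat _ _ _ n.+2) ?(leqW ltnj) //= big_nat_recr //= s_diag mul1r.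
rewrite big_nat_cond big1 ?add0r; last first.
  move=> m /andP[/= ltmn _].
  by rewrite IHn ?mulr0 // (ltn_trans ltmn).
rewrite big_nat_cond big1 ?addr0 // => m /andP[/andP[ltnm _] _].
by rewrite s_eq0 ?mul0r.
Qed.

Lemma sum_s_inv_s (n j : nat) : (0 < j <= n)%N ->
  \sum_(j <= m < n.+1) s_inv n m * s m j = (n == j)%:R.
Proof.
case/andP=> j0 lejn.
rewrite -(sum_s_inv_s_full n) ?leqnn ?j0 ?(leq_trans j0) //.
rewrite [RHS](@big_cat_nat _ _ _ j) ?leqW //= [X in _ = X + _]big_nat.
by rewrite [X in _ = X + _]big1 ?add0r // => m ltmj; rewrite s_eq0 ?mulr0.
Qed.

Lemma sum_s_s_inv (n j : nat) : (0 < j <= n)%N ->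
  \sum_(j <= m < n.+1) s n m * s_inv m j = (n == j)%:R.
Proof.
case/andP=> j0 lejn.
rewrite -(sum_s_s_inv_full n) ?leqnn ?j0 ?(leq_trans j0) //.
rewrite [RHS](@big_cat_nat _ _ _ j) ?leqW //= [X in _ = X + _]big_nat.
by rewrite [X in _ = X + _]big1 ?add0r // => m ltmj; rewrite s_inv_eq0 ?mulr0.
Qed.

Theorem proposition2p1 (n j : nat) (hj : (1 <= j)%N) (hjn : (j <= n)%N) :
  [/\ s_inv n j =
        - (\sum_(1 <= k < (n - j).+1) s_inv n (n + 1 - k) * s (n + 1 - k) j)
        + (n == j)%:R,
      s_inv n j =
        - (\sum_(1 <= k < (n - j).+1) s n (n - k) * s_inv (n - k) j)
        + (n == j)%:R
    & s_inv n j =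
        - (\sum_(1 <= k < n.+1) s n (k - 1) * s_inv (k - 1) j)
        + (n == j)%:R].
Proof.
have hjn' : (0 < j <= n)%N by rewrite hj.
have sjj : s j j = 1 by rewrite -(prednK hj) s_diag.
have snn : s n n = 1 by rewrite -(prednK (leq_trans hj hjn)) s_diag.
have second : s_inv n j =
    - (\sum_(j <= m < n) s n m * s_inv m j) + (n == j)%:R.
  by rewrite -(sum_s_s_inv _ _ hjn') big_nat_recr //= snn mul1r addKr.
split.
- rewrite -(sum_s_inv_s _ _ hjn') [X in _ + X]big_nat_recl //= sjj mulr1.
  rewrite [X in - X + _](_ : _ = \sum_(j <= m < n) s_inv n m.+1 * s m.+1 j).
    by rewrite addrC addrK.
  (* The substitution m.+1 = n + 1 - k reverses the range of summation. *)
  rewrite big_add1 big_mkord [RHS]big_rev_mkord; apply: eq_bigr => k _.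
  have ltkn : (k < n)%N by rewrite (leq_trans (ltn_ord k)) ?leq_subr.
  by rewrite addn1 subSn.
- by rewrite second big_add1 big_mkord [in LHS]big_rev_mkord.
- rewrite second big_add1 /= [in RHS](@big_cat_nat _ _ _ j) //=.
  rewrite [X in _ = - (X + _) + _]big_nat.
  rewrite [X in _ = - (X + _) + _]big1 ?add0r; last first.
    by move=> m ltmj; rewrite subn1 s_inv_eq0 ?mulr0.
  by congr (- _ + _); apply: eq_bigr => k _; rewrite subn1.
Qed.
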